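(* For all integers $1\le m\le n$ we have \[ \nu(n,m)\le e^{-u\log u+u-1},\qquad u=n/m. \]
   Context: $\nu(n,m)$ is the probability that a uniformly random permutation $\sigma$ in the symmetric group $\mathcal{S}_n$ on $\{1,\ldots,n\}$ has no cycle of length greater than $m$ (i.e. no cycle whose length lies in $\{m+1,\ldots,n\}$). *)

(* Defs.v *)
From HB Require Import structures.
From mathcomp Require Import all_boot all_order all_fingroup all_algebra.
From mathcomp Require Import all_classical all_reals all_analysis.

Set Implicit Arguments.
Unset Strict Implicit.
Unset Printing Implicit Defensive.

Import Order.TTheory GRing.Theory Num.Theory.

Local Open Scope ring_scope.

(* The cycles of s, fixed points included, are its orbits [porbits s], and the
   length of a cycle is the cardinality of the orbit. *)
Definition no_cycle_longer_than (n m : nat) (s : 'S_n) : bool :=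
  [forall C in porbits s, (#|C| <= m)%N].

Definition nu (R : realType) (n m : nat) : R :=
  #|[set s : 'S_n | no_cycle_longer_than m s]|%:R / #|[set: 'S_n]|%:R.

(* Main.v *)
Require Import Defs.
From HB Require Import structures.
From mathcomp Require Import all_boot all_order all_fingroup all_algebra.
From mathcomp Require Import all_classical all_reals all_analysis.
From mathcomp Require Import ring lra zify.

Set Implicit Arguments.
Unset Strict Implicit.
Unset Printing Implicit Defensive.

Import Order.TTheory GRing.Theory Num.Theory.

Local Open Scope ring_scope.

(** The counterpart of Dickman's delay equation on permutations is
    [n nu(n) = nu(n-1) + ... + nu(n-m)] for [n >= m]: the cycle of a given
    point has each length [k] with probability [1/n], and conditionally on it
    the other [n-k] points carry a uniform permutation.  Hence [nu(n)] is at
    most [m/n = 1/u] times the largest of the [m] preceding values.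

    Let [E(u) = exp (- u ln u + u - 1)], so that [E(1) = 1] and
    [(ln E)' = - ln].  On an interval of length at most one to the left of
    [u], the function [ln E] grows by at most [ln u], so [E(w) <= u E(u)] as
    soon as [1 <= w <= u <= w + 1] ([envelope_step]).  Therefore the bound
    [nu(k) <= E(max(k,m)/m)], trivial for [k <= m], propagates: the factor
    [1/u] of the recurrence cancels the loss of [u].

    The recurrence enters only as an upper bound ([card_smooth_cycle]): a
    permutation is determined by the list [x, s x, s (s x), ...] along the
    cycle of [x] together with its restriction to the complement of that
    cycle.  To restrict without changing the underlying type, the counting is
    done for permutations of a fixed finite type supported in a subset. *)

(** * Removing one cycle from a permutation *)

Section SmoothPermutations.
Variable T : finType.
Implicit Types (s : {perm T}) (A : {set T}) (x y : T) (m : nat).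

(** Points outside [A] are fixed, so their orbits of size one do not interfere
    with the length condition when [0 < m]: these are the permutations of [A]
    without cycles longer than [m]. *)
Definition smooth_perms m A : {set {perm T}} :=
  [set s : {perm T} | perm_on A s & [forall x, (#|porbit s x| <= m)%N]].

Lemma porbit_subset s s' :
  (forall y, s' y \in porbit s y) -> forall y, porbit s' y \subset porbit s y.
Proof.
move=> step y; apply/fintype.subsetP => z /porbitP[i ->].
elim: i => [|i IH]; first by rewrite perm1 porbit_id.
rewrite expgSr permM; rewrite -eq_porbit_mem in IH.
by rewrite -(eqP IH).
Qed.

(** [porbit s x] is [s]-stable, so the restriction to its complement is not
    the junk value [1] of [restr_perm]. *)
Lemma restr_perm_porbitC s x y :
  restr_perm (~: porbit s x) s y = if y \in porbit s x then y else s y.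
Proof.
have stab : s \in 'N(~: porbit s x | 'P)%g.
  rewrite !inE; apply/fintype.subsetP => z; rewrite !inE /aperm /= -!eq_porbit_mem.
  by have /= -> := porbit_perm s 1 z.
case: ifP => yC; last by rewrite restr_permE // !inE yC.
by rewrite (out_perm (restr_perm_on _ _)) // inE negbK.
Qed.

(** Restricting moves each point to itself or to its image under [s], so orbits
    can only shrink. *)
Lemma restr_perm_smooth m A s x :
  s \in smooth_perms m A ->
  restr_perm (~: porbit s x) s \in smooth_perms m (A :\: porbit s x).
Proof.
rewrite !inE => /andP[/fintype.subsetP sA /forallP sm]; apply/andP; split.
  apply/fintype.subsetP => y; rewrite !inE restr_perm_porbitC.
  by case: ifP => [|_ /sA ->]; rewrite ?eqxx.
apply/forallP => y; apply: leq_trans (sm y); apply: subset_leq_card.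
apply: porbit_subset => z; rewrite restr_perm_porbitC.
by case: ifP => _; [exact: porbit_id | have := mem_porbit s 1 z].
Qed.

(** Once the cycle of [x] is known as a list, only the restriction to its
    complement is left free; the restriction map is thus injective here. *)
Lemma card_smooth_fiber m A x j (t : j.-tuple T) :
  (#|[set s in smooth_perms m A | (#|porbit s x| == j.+1) &&
                                 (traject s (s x) j == t)]|
     <= #|smooth_perms m (A :\: [set y in x :: t])|)%N.
Proof.
set F := finset _.
have orbE s : s \in F -> porbit s x = [set y in x :: t].
  rewrite inE => /and3P[_ /eqP k /eqP tE].
  by apply/setP => y; rewrite porbit_traject k inE -tE.
pose f s := restr_perm (~: [set y in x :: t]) s.
have f_inj : {in F &, injective f}.
  move=> s1 s2 F1 F2 /permP eqf; apply/permP => y.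
  have := eqf y; rewrite /f -{1}(orbE _ F1) -(orbE _ F2) !restr_perm_porbitC.
  rewrite (orbE _ F1) (orbE _ F2); case: ifP => // yC _.
  move: yC; rewrite -(orbE _ F1) porbit_traject => /trajectP[i].
  move: F1 F2; rewrite !inE => /and3P[_ /eqP k1 /eqP t1] /and3P[_ /eqP k2 /eqP t2].
  have itE n : (n < j.+1)%N -> iter n s1 x = iter n s2 x.
    move=> nj; rewrite -(nth_traject s1 nj x) -(nth_traject s2 nj x) !trajectS.
    by rewrite t1 t2.
  have itS n : (n <= j.+1)%N -> iter n s1 x = iter n s2 x.
    (* At [n = j.+1] the cycle closes: both iterates are back at [x]. *)
    rewrite leq_eqVlt => /orP[/eqP->|]; last exact: itE.
    by rewrite -{1}k1 -k2 !iter_porbit.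
  by rewrite k1 => ij ->; rewrite -iterS itS // itE // -iterS.
rewrite -(card_in_imset f_inj); apply: subset_leq_card.
apply/fintype.subsetP => _ /imsetP[s sF ->]; rewrite /f -(orbE _ sF).
by apply: restr_perm_smooth; move: sF; rewrite inE => /andP[].
Qed.

(** The list [t] is the cycle of [x] without [x] itself. *)
Lemma card_smooth_cycle m A x j :
  x \in A ->
  (#|[set s in smooth_perms m A | #|porbit s x| == j.+1]|
    <= \sum_(t : j.-tuple T | all [in A :\ x] t && uniq t)
          #|smooth_perms m (A :\: [set y in x :: t])|)%N.
Proof.
move=> xA; set S := finset _.
pose g s : j.-tuple T := Tuple (introT eqP (size_traject s (s x) j)).
rewrite -sum1_card (partition_big g (fun t => all [in A :\ x] t && uniq t)) /=.
  apply: leq_sum => t _; rewrite sum1_card.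
  apply: leq_trans (card_smooth_fiber m A x t).
  apply: subset_leq_card; apply/fintype.subsetP => s.
  case/andP; rewrite finset.in_set => /andP[sA k] /eqP <-.
  by rewrite finset.in_set sA k /= eqxx.
move=> s; rewrite !inE => /andP[/andP[sA _] /eqP k].
have := uniq_traject_porbit s x; rewrite k /= => /andP[xt ->]; rewrite andbT.
apply/allP => y yt; have yx : y != x by apply: contraNneq xt => yx; rewrite -{1}yx.
rewrite !inE yx /=.
have : y \in porbit s x by rewrite porbit_traject k trajectS inE yt orbT.
case/porbitP => i ->; elim: i {yt} => [|i IH]; first by rewrite perm1.
by rewrite expgSr permM perm_closed.
Qed.

Lemma card_smooth_porbit_sum m A x :
  (#|smooth_perms m A|
    <= \sum_(j < m) #|[set s in smooth_perms m A | #|porbit s x| == j.+1]|)%N.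
Proof.
case: m => [|m].
  rewrite big_ord0 leqn0 cards_eq0; apply/eqP/setP => s; rewrite !inE.
  apply/negP => /andP[_ /forallP/(_ x)].
  by rewrite leqn0 (negbTE (card_porbit_neq0 s x)).
pose len (s : {perm T}) : 'I_m.+1 := inord #|porbit s x|.-1.
rewrite -sum1_card (partition_big len predT) //=.
apply: leq_sum => j _; rewrite sum1_card.
apply: subset_leq_card; apply/fintype.subsetP => s.
case/andP => sS /eqP <-; rewrite finset.in_set sS /= /len.
move: sS; rewrite finset.in_set => /andP[_ /forallP/(_ x)].
have := card_porbit_neq0 s x; case: #|porbit s x| => // k _ km.
by rewrite inordK.
Qed.

End SmoothPermutations.

(** * The recurrence and its solution *)

Section EntropyBound.
Variable R : realType.
Implicit Types u w : R.

Definition envelope u : R := expR (- (u * ln u) + u - 1).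

Lemma envelope1 : envelope 1 = 1.
Proof. by rewrite /envelope ln1 mulr0 oppr0 add0r subrr expR0. Qed.

(** After taking logarithms and using [u - w <= 1] to bound [(u - w) ln u] by
    [ln u], what remains is [w ln (u / w) <= u - w], which is
    [ln z <= z - 1] at [z = u / w]. *)
Lemma envelope_step u w :
  0 < w -> w <= u -> 1 <= u -> u - 1 <= w -> envelope w <= u * envelope u.
Proof.
move=> w0 wu u1 uw1.
have u0 : 0 < u by rewrite (lt_le_trans _ u1).
rewrite -[X in X * _](lnK (x := u)) ?posrE // /envelope -expRD ler_expR.
have /(ler_wpM2l (ltW w0)) : ln (u / w) <= u / w - 1.
  have -> : u / w = 1 + (u / w - 1) by rewrite addrC subrK.
  rewrite [X in _ <= X]addrAC subrr add0r; apply: le_ln1Dx.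
  by rewrite ltrBDr addrC subrr divr_gt0.
rewrite ln_div ?posrE // !mulrBr mulrC [w * (u / w)]mulrC divfK ?gt_eqF // mulr1.
have : (u - w) * ln u <= 1 * ln u.
  by apply: ler_wpM2r; [exact: ln_ge0 | rewrite lerBlDr -lerBlDl].
by lra.
Qed.

(** Truncating the argument below at one makes the bound the trivial [k`!] for
    [k <= m], the initial values of the recurrence. *)
Definition fact_envelope m k : R := (k`!)%:R * envelope ((maxn k m)%:R / m%:R).

Lemma fact_envelope_small m k :
  (0 < m)%N -> (k <= m)%N -> fact_envelope m k = k`!%:R.
Proof.
move=> m0 km; rewrite /fact_envelope (maxn_idPr km) divff ?envelope1 ?mulr1 //.
by rewrite pnatr_eq0 -lt0n.
Qed.

Lemma fact_envelope_step m n k : (m < n)%N -> (0 < k <= m)%N ->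
  fact_envelope m (n - k) <=
  (n - k)`!%:R * (n%:R / m%:R * envelope (n%:R / m%:R)).
Proof.
move=> mn /andP[k0 km]; have mR : 0 < m%:R :> R by rewrite ltr0n (leq_trans k0).
rewrite ler_wpM2l //; apply: envelope_step.
- by rewrite divr_gt0 // ltr0n; lia.
- by rewrite ler_pM2r ?invr_gt0 // ler_nat; lia.
- by rewrite ler_pdivlMr // mul1r ler_nat ltnW.
- rewrite lerBlDr ler_pdivrMr // mulrDl divfK ?gt_eqF // mul1r -natrD ler_nat.
  by lia.
Qed.

(** With [n = #|A|] and [k = j.+1], there are [(n - 1) ^_ (k - 1)] cycles of
    length [k] through [x], and [(n - 1) ^_ (k - 1) * (n - k)`! = (n - 1)`!]
    whatever [k] is: this is the uniformity of the cycle length of [x]. *)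
Lemma card_smooth_cycle_le (T : finType) m (A : {set T}) x j (b : R) :
  x \in A -> (j < #|A|)%N ->
  (forall B : {set T}, #|B| = (#|A| - j.+1)%N ->
     #|smooth_perms m B|%:R <= (#|B|)`!%:R * b) ->
  #|[set s in smooth_perms m A | #|porbit s x| == j.+1]|%:R
    <= (#|A|.-1)`!%:R * b.
Proof.
move=> xA jA Bb.
have cA : #|A| = #|A :\ x|.+1 by rewrite (cardsD1 x) xA.
apply: (@le_trans _ _ (\sum_(t : j.-tuple T | all [in A :\ x] t && uniq t)
         ((#|A| - j.+1)`!%:R * b))).
  apply: le_trans (_ : (\sum_(t : j.-tuple T | all [in A :\ x] t && uniq t)
           #|smooth_perms m (A :\: [set y in x :: t])|)%:R <= _).
    by rewrite ler_nat card_smooth_cycle.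
  rewrite natr_sum; apply: ler_sum => t /andP[tA tu].
  have cB : #|A :\: [set y in x :: t]| = (#|A| - j.+1)%N.
    have sub : [set y in x :: t] \subset A.
      apply/fintype.subsetP => y; rewrite inE in_cons => /predU1P[->//|].
      by move/(allP tA); rewrite !inE => /andP[].
    have xt : x \notin (t : seq T).
      by apply/negP => /(allP tA); rewrite !inE eqxx.
    rewrite cardsD (finset.setIidPr sub) cardsE (card_uniqP _) /= ?size_tuple //.
    by rewrite xt tu.
  by rewrite -cB; apply: Bb.
rewrite sumr_const -(cardsE (fun t : j.-tuple T => all [in A :\ x] t && uniq t)).
rewrite card_uniq_tuples -[X in X <= _]mulr_natl.
rewrite [X in X <= _]mulrA -natrM cA subSS /= ffact_fact //.
by rewrite -ltnS -cA.
Qed.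

Lemma card_smooth_perms_le (T : finType) m (A : {set T}) :
  (0 < m)%N -> #|smooth_perms m A|%:R <= fact_envelope m #|A|.
Proof.
move=> m0; have [N] := ubnP #|A|; elim: N A => // N IH A; rewrite ltnS => AN.
have [Am|mA] := leqP #|A| m.
  rewrite fact_envelope_small // ler_nat -card_perm; apply: subset_leq_card.
  by apply/fintype.subsetP => s; rewrite inE => /andP[].
have [x xA] : exists x, x \in A.
  by apply/set0Pn; rewrite -card_gt0 (leq_trans _ mA).
rewrite /fact_envelope (maxn_idPl (ltnW mA)); set u : R := _ / _.
apply: le_trans (_ : (\sum_(j < m)
   #|[set s in smooth_perms m A | #|porbit s x| == j.+1]|)%:R <= _).
  by rewrite ler_nat card_smooth_porbit_sum.
apply: (@le_trans _ _ (\sum_(j < m) ((#|A|.-1)`!%:R * (u * envelope u)))).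
  rewrite natr_sum; apply: ler_sum => j _; apply: card_smooth_cycle_le => //.
    exact: ltn_trans (ltn_ord j) mA.
  move=> B cB; apply: (@le_trans _ _ (fact_envelope m #|B|)).
    by apply: IH; rewrite cB; lia.
  by rewrite cB; apply: fact_envelope_step => //; exact: ltn_ord.
rewrite sumr_const card_ord -[X in X <= _]mulr_natl.
have -> : (#|A|)`! = (#|A| * (#|A|.-1)`!)%N by case: #|A| mA.
(* The [m] cycle lengths, each costing a factor [u], account together for the
   first factor of [(#|A|)`!]. *)
have mu : m%:R * u = #|A|%:R by rewrite mulrC divfK // pnatr_eq0 -lt0n.
by rewrite natrM -mu le_eqVlt; apply/orP; left; apply/eqP; ring.
Qed.

End EntropyBound.

Theorem theorem1p16 (R : realType) (n m : nat)
    (hm : (1 <= m)%N) (hmn : (m <= n)%N) :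
  let u : R := n%:R / m%:R in
  nu R n m <= expR (- (u * ln u) + u - 1).
Proof.
cbv zeta; rewrite /nu cardsT card_Sn ler_pdivrMr ?ltr0n ?fact_gt0 // mulrC.
have := card_smooth_perms_le R [set: 'I_n] hm.
rewrite /fact_envelope cardsT card_ord (maxn_idPl hmn); apply: le_trans.
rewrite ler_nat; apply: subset_leq_card; apply/fintype.subsetP => s.
rewrite !inE => /forallP sm; apply/andP; split; last first.
  by apply/forallP => y; apply: (implyP (sm _)); apply: imset_f.
by apply/fintype.subsetP => y; rewrite inE.
Qed.
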